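(* For an integer $l \ge 6$ and integers $j \ge 1$ with $3j \le l$, define $$g_l(j) = \frac{(l+j)^{(2j)}\,(l+j)^{(2j)}}{(l+3j)^{(2j)}\,(l-j)^{(2j)}}, \qquad h_l(j) = \frac{l+j}{l-j}.$$ Let $a$ range over positive integers. Then, as $a \to \infty$: (i) $\log g_{4a^2}(a) = \frac{1}{2a} - \frac{1}{32a^3} + O(a^{-5})$ and $\log h_{4a^2}(a) = \frac{1}{2a} + \frac{1}{96a^3} + O(a^{-5})$; (ii) $\log g_{4a^2}(a+1) = \frac{1}{2a} + \frac{3}{2a^2} + \frac{47}{32a^3} + \frac{19}{32a^4} + O(a^{-5})$ and $\log h_{4a^2}(a+1) = \frac{1}{2a} + \frac{1}{2a^2} + \frac{1}{96a^3} + \frac{1}{32a^4} + O(a^{-5})$; (iii) $\log g_{4a^2-1}(a) = \frac{1}{2a} + \frac{7}{32a^3} + O(a^{-5})$ and $\log h_{4a^2-1}(a) = \frac{1}{2a} + \frac{13}{96a^3} + O(a^{-5})$. Moreover, (iv) for every fixed integer $a \ge 3$, both $g_l(a)/h_l(a)$ and $g_l(a+1)/h_l(a+1)$ are strictly decreasing in $l$ for integers $l$ with $4a^2 \le l \le 4(a+1)^2 - 1$.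
   Context: For a real $x$ and integer $m \ge 0$, $x^{(m)} = x(x-1)\cdots(x-m+1)$ denotes the descending factorial power, with $x^{(0)}=1$. *)

(* Defs.v *)
From mathcomp Require Import all_boot all_order all_algebra.
From mathcomp Require Import all_classical all_reals all_analysis.

Set Implicit Arguments.
Unset Strict Implicit.
Unset Printing Implicit Defensive.

Import Order.TTheory GRing.Theory Num.Theory.
Import numFieldNormedType.Exports.

Local Open Scope ring_scope.

(* Descending factorial power x(x-1)...(x-m+1) of a real x, in contrast with
   the library's [n ^_ m], which is for natural numbers. *)
Definition descfact (R : realType) (x : R) (m : nat) : R :=
  \prod_(i < m) (x - i%:R).

(* [g R l j] and [h R l j] are meant for 6 <= l, 1 <= j and 3 * j <= l, where
   all denominators are positive; outside this range they take junk values.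
   All subtractions are in R, so none is truncated. *)
Definition g (R : realType) (l j : nat) : R :=
  (descfact (l%:R + j%:R) (2 * j) * descfact (l%:R + j%:R) (2 * j)) /
  (descfact (l%:R + 3 * j%:R) (2 * j) * descfact (l%:R - j%:R) (2 * j)).

Definition h (R : realType) (l j : nat) : R := (l%:R + j%:R) / (l%:R - j%:R).

(* Main.v *)
Require Import Defs.
From mathcomp Require Import all_boot all_order all_algebra.
From mathcomp Require Import all_classical all_reals all_analysis.
From mathcomp Require Import ring lra zify.

(* Writing [x = l + j - i] for the factors of [(l + j)^(2j)], one has
   [g_l(j) = prod_x 1 / (1 - 4 j^2 / x^2)]. With [z = j / l] and
   [u = (j - i) / l], so that [|u| <= z], each factor contributes
   [4 z^2 (1 - 2u + 3u^2 - 4u^3) + 8 z^4 (1 - 4u) + O(z^6)] to [ln g_l(j)].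
   The odd powers of [u] sum to lower order because the shifts [j - i] are
   symmetric about [1/2], which leaves
   [ln g_l(j) = 8 j z^2 - 8 z^3 + 24 j z^4 + O(a^-5)] when [z <= 1/a],
   [j <= 2a] and [1/l <= a^-2]. Likewise
   [ln h_l(j) = 2 z + 2 z^3 / 3 + O(z^5)]. Parts (i)-(iii) expand these in
   [y = 1/a], where [z = y/4], [z = y (1 + y) / 4] and [z = y / (4 - y^2)]
   respectively.
   For (iv), all but a few factors of [g_(l+1)(j) / g_l(j)] cancel, and
   [g/h] decreases from [l] to [l + 1 = n] iff [n^2 + 3 j^2 < 8 n j^2]. *)

Set Implicit Arguments.
Unset Strict Implicit.
Unset Printing Implicit Defensive.

Import Order.TTheory GRing.Theory Num.Theory.
Import numFieldNormedType.Exports.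

Local Open Scope classical_set_scope.
Local Open Scope ring_scope.

(** * Passage from explicit error bounds to big-O *)

Lemma eqaddO_inv_exp (R : realType) (f m p : nat -> R) (C D : R) (N k : nat) :
  (forall a, (N <= a)%N -> `|f a - m a| <= C * a%:R ^- k) ->
  (forall a, (N <= a)%N -> `|m a - p a| <= D * a%:R ^- k) ->
  f = p +O_\oo (fun a : nat => a%:R ^- k : R).
Proof.
move=> fm mp; apply/eqaddOP/bigO_exP.
(* The maximum with [1] keeps the constant positive for arbitrary [C] and [D]. *)
exists (Num.max (C + D) 1); first by rewrite lt_max ltr01 orbT.
exists N => //= a Na; apply: le_trans (ler_distD (m a) _ _) _.
apply: le_trans (lerD (fm a Na) (mp a Na)) _.
rewrite -mulrDl ger0_norm ?invr_ge0 ?exprn_ge0 //.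
by rewrite ler_wpM2r ?invr_ge0 ?exprn_ge0 // le_max lexx.
Qed.

(** * Logarithm of [(1 + z) / (1 - z)] and of one factor of [g] *)

Lemma ln_ratio_bounds (R : realType) (z : R) : 0 <= z -> z <= 1 / 2 ->
  0 <= ln ((1 + z) / (1 - z)) - 2 * z - 2 / 3 * z ^+ 3 <= 3 * z ^+ 5.
Proof.
move=> z0 z12.
(* [F] vanishes at [0], and for [x <= 1 / 2] its derivative [dF] lies between [0] and
   [8 / 3 * x ^+ 4]; the mean value theorem then bounds [F z]. *)
pose F (x : R) := ln (1 + x) - ln (1 - x) - 2 * x - 2 / 3 * x ^+ 3.
pose dF (x : R) := 2 * x ^+ 4 / (1 - x ^+ 2).
have F_drv (x : R) : 0 <= x -> x <= 1 / 2 -> is_derive x 1 F (dF x).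
  move=> x0 x12.
  have p1 : 0 < 1 + x by lra.
  have m1 : 0 < 1 - x by lra.
  have d1 : is_derive x 1 (fun y : R => 1 + y) 1.
    by apply: is_derive_eq; ring.
  have d2 : is_derive x 1 (fun y : R => 1 - y) (- 1).
    by apply: is_derive_eq; ring.
  have l1 := is_derive1_ln p1.
  have l2 := is_derive1_ln m1.
  have c1 := @is_derive1_comp R (@ln R) (fun y => 1 + y) x _ _ l1 d1.
  have c2 := @is_derive1_comp R (@ln R) (fun y => 1 - y) x _ _ l2 d2.
  rewrite /F; apply: is_derive_eq.
  rewrite /dF /GRing.scale /=; field.
  by rewrite !gt_eqF //; nra.
have Fc : {within `[0, z], continuous F}.
  apply: derivable_within_continuous => x; rewrite in_itv /= => /andP[x0 xz].
  by have [] := F_drv x x0 (le_trans xz z12).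
have [|c] := MVT_segment z0 _ Fc (df := dF).
  move=> x; rewrite in_itv /= => /andP[x0 xz].
  by apply: F_drv; lra.
rewrite in_itv /= => /andP[c0 cz].
have -> : F 0 = 0 by rewrite /F addr0 subr0 ln1; ring.
rewrite subr0 [z - 0]subr0 /F -ln_div ?posrE; [|lra|lra] => ->.
have c2 : c ^+ 2 <= 1 / 4 by nra.
have c4 : c ^+ 4 <= z ^+ 4 by rewrite lerXn2r // ?nnegrE //; lra.
rewrite /dF mulrAC divr_ge0 /=; last lra.
  rewrite ler_pdivrMr; last lra.
  have : c ^+ 4 * z <= z ^+ 4 * z by rewrite ler_wpM2r.
  rewrite -exprSr => h1.
  have z5 : 0 <= z ^+ 5 by rewrite exprn_ge0.
  nra.
by rewrite !mulr_ge0 // exprn_ge0.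
Qed.

(* With [s = t / (2 - t)] one has [1 / (1 - t) = (1 + s) / (1 - s)]; here
   [t = 4 z^2 / (1 + u)^2] is the defect of one factor of [g]. *)
Lemma ln_factor_bound (R : realType) (z u : R) :
  0 <= z -> z <= 1 / 8 -> `|u| <= z ->
  `|ln ((1 + u) ^+ 2 / ((1 + u) ^+ 2 - 4 * z ^+ 2))
    - (4 * z ^+ 2 * (1 - 2 * u + 3 * u ^+ 2 - 4 * u ^+ 3)
       + 8 * z ^+ 4 * (1 - 4 * u))| <= 300 * z ^+ 6.
Proof.
move=> z0 z8 uz.
have /andP[zu uz'] : - z <= u <= z by rewrite -ler_norml.
have z2 : 0 <= z ^+ 2 <= 1 / 64 by apply/andP; split; nra.
have u2 : u ^+ 2 <= z ^+ 2 by nra.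
pose D := (1 + u) ^+ 2 - 2 * z ^+ 2.
have D0 : 47 / 64 <= D by rewrite /D; nra.
pose s := 2 * z ^+ 2 / D.
have s0 : 0 <= s by apply: divr_ge0; lra.
have s3 : s <= 3 * z ^+ 2 by rewrite ler_pdivrMr; nra.
have s12 : s <= 1 / 2 by lra.
have -> : (1 + u) ^+ 2 / ((1 + u) ^+ 2 - 4 * z ^+ 2) = (1 + s) / (1 - s).
  rewrite /s /D; field; rewrite -/D.
  by rewrite !gt_eqF //; rewrite /D in D0 *; nra.
have /andP[lo hi] := ln_ratio_bounds s0 s12.
have z6 : 0 <= z ^+ 6 by apply: exprn_ge0.
have s3z : s ^+ 3 <= 27 * z ^+ 6.
  have -> : 27 * z ^+ 6 = (3 * z ^+ 2) ^+ 3 by ring.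
  by rewrite lerXn2r // nnegrE //; lra.
have s30 : 0 <= s ^+ 3 by apply: exprn_ge0.
have s5 : s ^+ 5 <= s ^+ 3 / 4.
  have -> : s ^+ 5 = s ^+ 3 * s ^+ 2 by ring.
  by rewrite ler_wpM2l //; nra.
(* [B] is [1 - D * (1 - 2u + 3u^2 - 4u^3 + 2z^2 (1 - 4u))]. All terms of degree below 4 in [u] and
   [z] cancel, so [B] is of order [z^4]. *)
pose B := 5 * u ^+ 4 + 4 * u ^+ 5 + 20 * u ^+ 2 * z ^+ 2 + 4 * z ^+ 4
          - 16 * u * z ^+ 4.
have sE : 2 * s - (4 * z ^+ 2 * (1 - 2 * u + 3 * u ^+ 2 - 4 * u ^+ 3)
       + 8 * z ^+ 4 * (1 - 4 * u)) = 4 * z ^+ 2 * B / D.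
  by rewrite /s /B /D; field; rewrite -/D gt_eqF //; lra.
have z40 : 0 <= z ^+ 4 by apply: exprn_ge0.
have u4 : 0 <= u ^+ 4 <= z ^+ 4.
  have -> : u ^+ 4 = (u ^+ 2) ^+ 2 by ring.
  have -> : z ^+ 4 = (z ^+ 2) ^+ 2 by ring.
  by rewrite sqr_ge0 lerXn2r // nnegrE sqr_ge0.
have u2z : 0 <= u ^+ 2 * z ^+ 2 <= z ^+ 4.
  have -> : z ^+ 4 = z ^+ 2 * z ^+ 2 by ring.
  by apply/andP; split; nra.
have u5 : - (z ^+ 4 / 8) <= u ^+ 5 <= z ^+ 4 / 8.
  have -> : u ^+ 5 = u ^+ 4 * u by ring.
  by apply/andP; split; nra.
have uz4 : - (z ^+ 4 / 8) <= u * z ^+ 4 <= z ^+ 4 / 8.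
  by apply/andP; split; nra.
have B0 : 0 <= B by rewrite /B; lra.
have B1 : B <= 32 * z ^+ 4 by rewrite /B; lra.
have E0 : 0 <= 4 * z ^+ 2 * B / D by apply: divr_ge0; nra.
have E1 : 4 * z ^+ 2 * B / D <= 180 * z ^+ 6.
  rewrite ler_pdivrMr; last lra.
  have -> : z ^+ 6 = z ^+ 2 * z ^+ 4 by ring.
  have h1 : z ^+ 2 * B <= z ^+ 2 * (32 * z ^+ 4) by rewrite ler_wpM2l //; lra.
  have h2 : 0 <= z ^+ 2 * z ^+ 4 by apply: mulr_ge0 => //; lra.
  nra.
(* The terms in [s^3] and [s^5] add at most [(2/3 + 3/4) * 27 z^6 < 39 z^6] to the [180 z^6]
   above. *)
by rewrite ler_norml; apply/andP; split; lra.
Qed.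

(** * Expansions of [ln g] and [ln h] in powers of [z] *)

Lemma sum_cubic (R : numFieldType) (c0 c1 c2 c3 c : R) (n : nat) :
  \sum_(i < n) (c0 + c1 * (c - i%:R) + c2 * (c - i%:R) ^+ 2
                + c3 * (c - i%:R) ^+ 3) =
  c0 * n%:R + c1 * (n%:R * c - n%:R * (n%:R - 1) / 2)
  + c2 * (n%:R * c ^+ 2 - n%:R * (n%:R - 1) * c
          + n%:R * (n%:R - 1) * (2 * n%:R - 1) / 6)
  + c3 * (n%:R * c ^+ 3 - 3 / 2 * n%:R * (n%:R - 1) * c ^+ 2
          + n%:R * (n%:R - 1) * (2 * n%:R - 1) / 2 * c
          - (n%:R * (n%:R - 1) / 2) ^+ 2).
Proof.
elim: n => [|n IH]; first by rewrite big_ord0; ring.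
by rewrite big_ord_recr /= IH -natr1; field.
Qed.

Lemma ln_prod_ord (R : realType) (n : nat) (F : 'I_n -> R) :
  (forall i, 0 < F i) -> ln (\prod_(i < n) F i) = \sum_(i < n) ln (F i).
Proof.
(* [ln] turns products into sums only for positive arguments, so the induction carries positivity of
   the partial product. *)
move=> F0; pose K (x y : R) := 0 < x /\ ln x = y.
suff [] : K (\prod_(i < n) F i) (\sum_(i < n) ln (F i)) by [].
apply: (big_rec2 K); first by split; rewrite ?ln1.
by move=> i y x _ [x0 <-]; split; rewrite ?mulr_gt0 // lnM ?posrE.
Qed.

(* In [g] the factors of the denominator are [(x + 2j) (x - 2j)], where [x]
   runs through the factors [l + j - i] of the numerator. *)
Lemma g_prod (R : realType) (l j : nat) : (0 < l)%N ->
  g R l j = \prod_(i < 2 * j)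
    ((1 + (j%:R - i%:R) / l%:R) ^+ 2 /
     ((1 + (j%:R - i%:R) / l%:R) ^+ 2 - 4 * (j%:R / l%:R) ^+ 2)).
Proof.
move=> l0; have l0' : l%:R != 0 :> R by rewrite pnatr_eq0 -lt0n.
rewrite /g /descfact -!big_split /= -prodf_div; apply: eq_bigr => i _.
set x : R := l%:R + j%:R - i%:R.
have -> : 1 + (j%:R - i%:R) / l%:R = x / l%:R by rewrite /x; field.
have -> : (l%:R + 3 * j%:R - i%:R) * (l%:R - j%:R - i%:R)
  = x ^+ 2 - 4 * j%:R ^+ 2 by rewrite /x; ring.
have -> : (x / l%:R) ^+ 2 - 4 * (j%:R / l%:R) ^+ 2
  = (x ^+ 2 - 4 * j%:R ^+ 2) / l%:R ^+ 2 by field.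
by rewrite -expr2 expr_div_n invf_div [RHS]mulrA divfK // expf_neq0.
Qed.

Lemma ln_g_bound (R : realType) (l j : nat) (z : R) :
  (0 < j)%N -> (8 * j <= l)%N -> z = j%:R / l%:R ->
  `|ln (g R l j) - (8 * j%:R * z ^+ 2 - 8 * z ^+ 3 + 24 * j%:R * z ^+ 4)|
  <= 600 * j%:R * z ^+ 6 + 48 * z ^+ 5 + 4 * z ^+ 3 / l%:R.
Proof.
move=> j0 jl zE.
have l0 : (0 < l)%N by apply: leq_trans jl; rewrite muln_gt0.
have L0 : 0 < l%:R :> R by rewrite ltr0n.
have J0 : 0 < j%:R :> R by rewrite ltr0n.
have JL : 8 * j%:R <= l%:R :> R by rewrite -natrM ler_nat.
have z0 : 0 <= z by rewrite zE divr_ge0 // ltW.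
have z8 : z <= 1 / 8 by rewrite zE ler_pdivrMr //; lra.
pose u (i : 'I_(2 * j)) : R := (j%:R - i%:R) / l%:R.
have uz i : `|u i| <= z.
  have L0' : 0 <= l%:R^-1 :> R by rewrite invr_ge0 ltW.
  rewrite /u zE normrM (ger0_norm L0') ler_wpM2r // ler_norml.
  have : (i%:R : R) <= 2 * j%:R by rewrite -natrM ler_nat ltnW.
  have : 0 <= (i%:R : R) by [].
  by move=> *; apply/andP; split; lra.
rewrite g_prod // ln_prod_ord; last first.
  move=> i; rewrite -/(u i) -zE; have := uz i; rewrite ler_norml => /andP[? ?].
  by apply: divr_gt0; nra.
pose T (v : R) := 4 * z ^+ 2 * (1 - 2 * v + 3 * v ^+ 2 - 4 * v ^+ 3)
  + 8 * z ^+ 4 * (1 - 4 * v).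
(* The shifts [j - i] run from [j] down to [1 - j], so in odd degree [k] all but [j^k] cancels. The
   last bracket is an exact remainder, absorbed into the error bound. *)
have sumT : \sum_(i < 2 * j) T (u i)
  = 8 * j%:R * z ^+ 2 - 8 * z ^+ 3 + 24 * j%:R * z ^+ 4
    + (4 * z ^+ 3 / l%:R - 48 * z ^+ 5).
  pose c0 := 4 * z ^+ 2 + 8 * z ^+ 4.
  pose c1 := - (8 * z ^+ 2 + 32 * z ^+ 4) / l%:R.
  pose c2 := 12 * z ^+ 2 / l%:R ^+ 2.
  pose c3 := - (16 * z ^+ 2) / l%:R ^+ 3.
  under eq_bigr => i _.
    have -> : T (u i) = c0 + c1 * (j%:R - i%:R) + c2 * (j%:R - i%:R) ^+ 2
      + c3 * (j%:R - i%:R) ^+ 3.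
      by rewrite /T /u /c0 /c1 /c2 /c3; field; rewrite gt_eqF.
    over.
  rewrite sum_cubic natrM /c0 /c1 /c2 /c3 zE.
  by field; rewrite gt_eqF.
set M := _ + 24 * _ * _ in sumT *; set S := \sum_(i < _) _.
have dS : `|S - \sum_(i < 2 * j) T (u i)| <= 600 * j%:R * z ^+ 6.
  rewrite /S -sumrB; apply: (le_trans (ler_norm_sum _ _ _)).
  have -> : 600 * j%:R * z ^+ 6 = \sum_(i < 2 * j) (300 * z ^+ 6).
    by rewrite sumr_const card_ord -[RHS]mulr_natr natrM; ring.
  by apply: ler_sum => i _; rewrite -zE; exact: (ln_factor_bound z0 z8 (uz i)).
have z3 : 0 <= 4 * z ^+ 3 / l%:R by rewrite !mulr_ge0 // ?exprn_ge0 ?invr_ge0 // (ltW L0).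
have z5 : 0 <= z ^+ 5 by rewrite exprn_ge0.
move: dS; rewrite sumT !ler_norml => /andP[? ?].
by apply/andP; split; lra.
Qed.

(** With [y = 1/a] the hypotheses give [z <= y], [j y <= 2] and [1/l <= y^2], so the three error
    terms are at most [1200], [48] and [4] times [y^5]. *)
Lemma ln_g_asymptotic (R : realType) (l j a : nat) (z : R) :
  (0 < a)%N -> (0 < j)%N -> (8 * j <= l)%N -> (a * j <= l)%N ->
  (j <= 2 * a)%N -> (a ^ 2 <= l)%N -> z = j%:R / l%:R ->
  `|ln (g R l j) - (8 * j%:R * z ^+ 2 - 8 * z ^+ 3 + 24 * j%:R * z ^+ 4)|
  <= 1252 * a%:R ^- 5.
Proof.
move=> a0 j0 jl ajl ja al zE; apply: (le_trans (ln_g_bound j0 jl zE)).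
have l0 : (0 < l)%N by apply: leq_trans jl; rewrite muln_gt0.
have L0 : 0 < l%:R :> R by rewrite ltr0n.
have A0 : 0 < a%:R :> R by rewrite ltr0n.
pose y : R := a%:R^-1; have y0 : 0 < y by rewrite invr_gt0.
have z0 : 0 <= z by rewrite zE divr_ge0.
have zy : z <= y.
  by rewrite zE /y ler_pdivrMr // ler_pdivlMl // -natrM ler_nat.
have jy : j%:R * y <= 2.
  by rewrite /y ler_pdivrMr // -natrM ler_nat.
have ly : l%:R^-1 <= y ^+ 2.
  by rewrite /y exprVn lef_pV2 ?posrE ?exprn_gt0 // -natrX ler_nat.
rewrite -exprVn -/y.
have zn n : z ^+ n <= y ^+ n by rewrite lerXn2r // nnegrE // ltW.
have z3l : z ^+ 3 / l%:R <= y ^+ 5.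
  by rewrite (exprD y 3 2) ler_pM // ?exprn_ge0 // invr_ge0 ltW.
have jz6 : j%:R * z ^+ 6 <= 2 * y ^+ 5.
  apply: (@le_trans _ _ (j%:R * y ^+ 6)); first by rewrite ler_wpM2l.
  by rewrite exprS mulrA ler_wpM2r // exprn_ge0 // ltW.
by have := zn 5; lra.
Qed.

Lemma ln_h_asymptotic (R : realType) (l j a : nat) (z : R) :
  (0 < a)%N -> (0 < l)%N -> (2 * j <= l)%N -> (a * j <= l)%N ->
  z = j%:R / l%:R ->
  `|ln (h R l j) - (2 * z + 2 / 3 * z ^+ 3)| <= 3 * a%:R ^- 5.
Proof.
move=> a0 l0 jl ajl zE.
have L0 : 0 < l%:R :> R by rewrite ltr0n.
have A0 : 0 < a%:R :> R by rewrite ltr0n.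
have JL : 2 * j%:R <= l%:R :> R by rewrite -natrM ler_nat.
have z0 : 0 <= z by rewrite zE divr_ge0.
have z2 : z <= 1 / 2 by rewrite zE ler_pdivrMr //; lra.
have -> : h R l j = (1 + z) / (1 - z).
  by rewrite /h zE; field; rewrite !gt_eqF //; lra.
have zy : z <= a%:R^-1.
  by rewrite zE ler_pdivrMr // ler_pdivlMl // -natrM ler_nat.
have z5 : z ^+ 5 <= a%:R ^- 5.
  by rewrite -exprVn lerXn2r // nnegrE // invr_ge0 ltW.
have y5 : 0 <= a%:R ^- 5 :> R by rewrite invr_ge0 exprn_ge0.
have /andP[? ?] := ln_ratio_bounds z0 z2.
by rewrite ler_norml; apply/andP; split; lra.
Qed.

(** * Dependence of [g] and [g / h] on [l] *)

Lemma descfactS (R : realType) (x : R) (m : nat) :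
  descfact (x + 1) m * (x + 1 - m%:R) = (x + 1) * descfact x m.
Proof.
(* Both sides are one product of [m + 1] factors, with its last or its first factor split off. *)
have <- : \prod_(i < m.+1) (x + 1 - i%:R) = descfact (x + 1) m * (x + 1 - m%:R).
  by rewrite big_ord_recr.
rewrite big_ord_recl subr0; congr (_ * _); apply: eq_bigr => i _.
by rewrite /= -natr1; ring.
Qed.

Lemma descfact_gt0 (R : realType) (x : R) (m : nat) :
  m%:R < x + 1 -> 0 < descfact x m.
Proof.
move=> mx; apply: prodr_gt0 => i _.
have : i.+1%:R <= m%:R :> R by rewrite ler_nat.
by rewrite -natr1; lra.
Qed.

Lemma g_gt0 (R : realType) (l j : nat) : (3 * j < l.+1)%N -> 0 < g R l j.
Proof.
move=> jl; have : 3 * j%:R < l%:R + 1 :> R by rewrite natr1 -natrM ltr_nat.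
have : 0 <= j%:R :> R by [].
by move=> *; rewrite /g divr_gt0 // mulr_gt0 // descfact_gt0 // natrM; lra.
Qed.

(** Raising [l] by one multiplies the descending powers at [l + j], [l + 3j], [l - j] by
    [(n + j) / (n - j)], [(n + 3j) / (n + j)], [(n - j) / (n - 3j)]. *)
Lemma g_succ (R : realType) (l j : nat) (n : R) :
  (3 * j <= l)%N -> n = l.+1%:R ->
  g R l.+1 j = g R l j * (((n + j%:R) ^+ 3 * (n - 3 * j%:R)) /
                          ((n - j%:R) ^+ 3 * (n + 3 * j%:R))).
Proof.
move=> jl nE; set J : R := j%:R.
have lE : l%:R = n - 1 :> R by rewrite nE -natr1; ring.
have J0 : 0 <= J by [].
have JL : 3 * J <= n - 1 by rewrite -lE -natrM ler_nat.
rewrite /g -/J -nE lE.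
have Sp := descfactS (n - 1 + J) (2 * j).
have Sq := descfactS (n - 1 + 3 * J) (2 * j).
have Sr := descfactS (n - 1 - J) (2 * j).
have mE : (2 * j)%:R = 2 * J :> R by rewrite natrM.
rewrite (_ : n - 1 + J + 1 = n + J) in Sp; last by ring.
rewrite (_ : n - 1 + 3 * J + 1 = n + 3 * J) in Sq; last by ring.
rewrite (_ : n - 1 - J + 1 = n - J) in Sr; last by ring.
rewrite mE in Sp Sq Sr.
have q0 : 0 < descfact (n - 1 + 3 * J) (2 * j) by apply: descfact_gt0; lra.
have r0 : 0 < descfact (n - 1 - J) (2 * j) by apply: descfact_gt0; lra.
have -> : descfact (n + J) (2 * j)
  = (n + J) * descfact (n - 1 + J) (2 * j) / (n - J).
  by rewrite -Sp; field; rewrite gt_eqF //; lra.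
have -> : descfact (n + 3 * J) (2 * j)
  = (n + 3 * J) * descfact (n - 1 + 3 * J) (2 * j) / (n + J).
  by rewrite -Sq; field; rewrite gt_eqF //; lra.
have -> : descfact (n - J) (2 * j)
  = (n - J) * descfact (n - 1 - J) (2 * j) / (n - 3 * J).
  by rewrite -Sr; field; rewrite gt_eqF //; lra.
by field; rewrite !gt_eqF //; lra.
Qed.

(* After cancellation the claim is that
   [(n - j)^2 (n + 3j) (n - 1 - j) - (n + j)^2 (n - 3j) (n - 1 + j)], which
   equals [2 j (8 n j^2 - 3 j^2 - n^2)] with [n = l + 1], is positive. *)
Lemma g_div_h_succ_lt (R : realType) (l j : nat) :
  (0 < j)%N -> (3 * j <= l)%N ->
  (l.+1 ^ 2 + 3 * j ^ 2 < 8 * l.+1 * j ^ 2)%N ->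
  g R l.+1 j / h R l.+1 j < g R l j / h R l j.
Proof.
move=> j0 jl nj; pose n : R := l.+1%:R; pose J : R := j%:R.
have lE : l%:R = n - 1 :> R by rewrite /n -natr1; ring.
have J0 : 0 < J by rewrite ltr0n.
have JL : 3 * J <= n - 1 by rewrite -lE -natrM ler_nat.
have NJ : n ^+ 2 + 3 * J ^+ 2 < 8 * n * J ^+ 2.
  by rewrite /n /J -!natrX -!natrM -natrD ltr_nat.
have g0 : 0 < g R l j by apply: g_gt0.
rewrite (g_succ jl (erefl n)) -mulrA ltr_pM2l // /h -/J -/n lE.
rewrite !invf_div mulrA.
rewrite ltr_pdivlMr; last by lra.
rewrite -subr_gt0.
set X := (X in 0 < X).
have -> : X = 2 * J * (8 * n * J ^+ 2 - (n ^+ 2 + 3 * J ^+ 2)) /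
  ((n - J) ^+ 2 * (n + 3 * J)).
  by rewrite /X; field; rewrite !gt_eqF //; lra.
by rewrite divr_gt0 // mulr_gt0 // ?exprn_gt0; lra.
Qed.

(** Chains the one-step inequalities; [n] is the upper end of a step, hence the range
    [lo < n <= hi]. *)
Lemma g_div_h_lt (R : realType) (j lo hi l l' : nat) :
  (0 < j)%N -> (3 * j <= lo)%N ->
  (forall n, (lo < n)%N -> (n <= hi)%N -> (n ^ 2 + 3 * j ^ 2 < 8 * n * j ^ 2)%N) ->
  (lo <= l)%N -> (l < l')%N -> (l' <= hi)%N ->
  g R l' j / h R l' j < g R l j / h R l j.
Proof.
move=> j0 jlo nj lol; elim: l' => // l' IH; rewrite ltnS leq_eqVlt.
have step m : (l <= m)%N -> (m < hi)%N ->
  g R m.+1 j / h R m.+1 j < g R m j / h R m j.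
  move=> lm mhi; have lom := leq_trans lol lm.
  by apply: g_div_h_succ_lt => //; [exact: leq_trans lom | exact: nj].
case/predU1P => [<-|ll'] hi'; first exact: step.
by apply: lt_trans (IH ll' (ltnW hi')); apply: step => //; exact: ltnW.
Qed.

(** * Expansions in [y = 1/a]: lagged for [l = 4a^2 - 1], [j = a]; shifted for [l = 4a^2],
    [j = a + 1 = (1 + y) / y] *)

Lemma g_expansion_lagged (R : realType) (y z : R) :
  0 < y -> y <= 1 / 4 -> z = y / (4 - y ^+ 2) ->
  `|8 / y * z ^+ 2 - 8 * z ^+ 3 + 24 / y * z ^+ 4 - (y / 2 + 7 / 32 * y ^+ 3)|
  <= 10 * y ^+ 5.
Proof.
move=> y0 y4 zE.
have D : 63 / 16 <= 4 - y ^+ 2 by nra.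
pose w := (4 - y ^+ 2)^-1.
have w0 : 0 <= w by rewrite invr_ge0; lra.
have w1 : w <= 1 / 3 by rewrite /w -[X in _ <= X]invf_div lef_pV2 ?posrE; lra.
have y5 : 0 <= y ^+ 5 by rewrite exprn_ge0 // ltW.
(* The exact remainder over [y^5], found from [w - 1/4 = y^2 w / 4]; its three terms come from
   [8 w^2], [- 8 w^3] and [24 w^4]. *)
pose Q := (3 / 2 - y ^+ 2 / 4) * w ^+ 2
  - 2 * w * (w ^+ 2 + w / 4 + 1 / 16)
  + 3 / 2 * (8 - y ^+ 2) * w ^+ 2 * (w ^+ 2 + 1 / 16).
have -> : 8 / y * z ^+ 2 - 8 * z ^+ 3 + 24 / y * z ^+ 4
  - (y / 2 + 7 / 32 * y ^+ 3) = y ^+ 5 * Q.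
  rewrite zE /Q /w; field; rewrite !gt_eqF //; lra.
have w2 : 0 <= w ^+ 2 <= 1 / 9 by apply/andP; split; nra.
have y2 : 0 <= y ^+ 2 <= 1 / 16 by apply/andP; split; nra.
have a1 : 0 <= (3 / 2 - y ^+ 2 / 4) * w ^+ 2 <= 1 by apply/andP; split; nra.
have a2 : 0 <= w * (w ^+ 2 + w / 4 + 1 / 16) <= 1 by apply/andP; split; nra.
have a3 : 0 <= w ^+ 2 * (w ^+ 2 + 1 / 16) <= 1 / 9 by apply/andP; split; nra.
have a4 : 0 <= (8 - y ^+ 2) * (w ^+ 2 * (w ^+ 2 + 1 / 16)) <= 1.
  by apply/andP; split; nra.
have /andP[Q0 Q1] : -10 <= Q <= 10.
  by rewrite /Q -!mulrA; apply/andP; split; lra.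
by rewrite ler_norml; apply/andP; split; nra.
Qed.

Lemma h_expansion_lagged (R : realType) (y z : R) :
  0 < y -> y <= 1 / 4 -> z = y / (4 - y ^+ 2) ->
  `|2 * z + 2 / 3 * z ^+ 3 - (y / 2 + 13 / 96 * y ^+ 3)| <= 10 * y ^+ 5.
Proof.
move=> y0 y4 zE.
have D : 63 / 16 <= 4 - y ^+ 2 by nra.
pose w := (4 - y ^+ 2)^-1.
have w0 : 0 <= w by rewrite invr_ge0; lra.
have w1 : w <= 1 / 3 by rewrite /w -[X in _ <= X]invf_div lef_pV2 ?posrE; lra.
have y5 : 0 <= y ^+ 5 by rewrite exprn_ge0 // ltW.
pose Q := w / 8 + 1 / 6 * (w * (w ^+ 2 + w / 4 + 1 / 16)).
have -> : 2 * z + 2 / 3 * z ^+ 3 - (y / 2 + 13 / 96 * y ^+ 3) = y ^+ 5 * Q.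
  by rewrite zE /Q /w; field; rewrite !gt_eqF //; lra.
have a2 : 0 <= w * (w ^+ 2 + w / 4 + 1 / 16) <= 1 by apply/andP; split; nra.
have /andP[Q0 Q1] : -10 <= Q <= 10 by rewrite /Q; apply/andP; split; lra.
by rewrite ler_norml; apply/andP; split; nra.
Qed.

Lemma g_expansion_shifted (R : realType) (y z : R) :
  0 < y -> y <= 1 / 4 -> z = y * (1 + y) / 4 ->
  `|8 * ((1 + y) / y) * z ^+ 2 - 8 * z ^+ 3 + 24 * ((1 + y) / y) * z ^+ 4
    - (y / 2 + 3 / 2 * y ^+ 2 + 47 / 32 * y ^+ 3 + 19 / 32 * y ^+ 4)|
  <= 10 * y ^+ 5.
Proof.
move=> y0 y4 zE.
have y5 : 0 <= y ^+ 5 by rewrite exprn_ge0 // ltW.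
(* Here [z] is a polynomial in [y], so the remainder is [y^5] times a polynomial. *)
pose Q := (18 + 26 * y + 15 * y ^+ 2 + 3 * y ^+ 3) / 32.
have -> : 8 * ((1 + y) / y) * z ^+ 2 - 8 * z ^+ 3 + 24 * ((1 + y) / y) * z ^+ 4
    - (y / 2 + 3 / 2 * y ^+ 2 + 47 / 32 * y ^+ 3 + 19 / 32 * y ^+ 4)
  = y ^+ 5 * Q by rewrite zE /Q; field; rewrite gt_eqF.
have y2 : 0 <= y ^+ 2 <= 1 by apply/andP; split; nra.
have y3 : 0 <= y ^+ 3 <= 1 by rewrite exprn_ge0 ?exprn_ile1; lra.
have /andP[Q0 Q1] : 0 <= Q <= 10 by rewrite /Q; apply/andP; split; lra.
by rewrite ler_norml; apply/andP; split; nra.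
Qed.

Lemma h_expansion_shifted (R : realType) (y z : R) :
  0 < y -> y <= 1 / 4 -> z = y * (1 + y) / 4 ->
  `|2 * z + 2 / 3 * z ^+ 3
    - (y / 2 + y ^+ 2 / 2 + y ^+ 3 / 96 + y ^+ 4 / 32)| <= 10 * y ^+ 5.
Proof.
move=> y0 y4 zE.
have y5 : 0 <= y ^+ 5 by rewrite exprn_ge0 // ltW.
have -> : 2 * z + 2 / 3 * z ^+ 3
    - (y / 2 + y ^+ 2 / 2 + y ^+ 3 / 96 + y ^+ 4 / 32)
  = y ^+ 5 * ((3 + y) / 96) by rewrite zE; field.
by rewrite ler_norml; apply/andP; split; nra.
Qed.

Theorem theorem1p2 (R : realType) :
  (* (i) *)
  ((fun a : nat => ln (g R (4 * a ^ 2) a)) =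
     (fun a : nat => 1 / (2 * a%:R) - 1 / (32 * a%:R ^+ 3))
     +O_\oo (fun a : nat => a%:R ^- 5 : R)) /\
  ((fun a : nat => ln (h R (4 * a ^ 2) a)) =
     (fun a : nat => 1 / (2 * a%:R) + 1 / (96 * a%:R ^+ 3))
     +O_\oo (fun a : nat => a%:R ^- 5 : R)) /\
  (* (ii) *)
  ((fun a : nat => ln (g R (4 * a ^ 2) (a + 1))) =
     (fun a : nat => 1 / (2 * a%:R) + 3 / (2 * a%:R ^+ 2)
        + 47 / (32 * a%:R ^+ 3) + 19 / (32 * a%:R ^+ 4))
     +O_\oo (fun a : nat => a%:R ^- 5 : R)) /\
  ((fun a : nat => ln (h R (4 * a ^ 2) (a + 1))) =
     (fun a : nat => 1 / (2 * a%:R) + 1 / (2 * a%:R ^+ 2)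
        + 1 / (96 * a%:R ^+ 3) + 1 / (32 * a%:R ^+ 4))
     +O_\oo (fun a : nat => a%:R ^- 5 : R)) /\
  (* (iii) *)
  ((fun a : nat => ln (g R (4 * a ^ 2 - 1) a)) =
     (fun a : nat => 1 / (2 * a%:R) + 7 / (32 * a%:R ^+ 3))
     +O_\oo (fun a : nat => a%:R ^- 5 : R)) /\
  ((fun a : nat => ln (h R (4 * a ^ 2 - 1) a)) =
     (fun a : nat => 1 / (2 * a%:R) + 13 / (96 * a%:R ^+ 3))
     +O_\oo (fun a : nat => a%:R ^- 5 : R)) /\
  (* (iv) *)
  (forall a : nat, (3 <= a)%N -> forall l l' : nat,
     (4 * a ^ 2 <= l)%N -> (l < l')%N -> (l' <= 4 * (a + 1) ^ 2 - 1)%N ->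
     g R l' a / h R l' a < g R l a / h R l a /\
     g R l' (a + 1) / h R l' (a + 1) < g R l (a + 1) / h R l (a + 1)).
Proof.
(* The threshold [4 <= a] gives the [y <= 1 / 4] required by the expansions. *)
have y0 a : (4 <= a)%N -> 0 < a%:R^-1 :> R.
  by move=> a4; rewrite invr_gt0 ltr0n; exact: leq_trans a4.
have yN a : (4 <= a)%N -> a%:R != 0 :> R.
  by move=> a4; rewrite pnatr_eq0 -lt0n; exact: leq_trans a4.
have y4 a : (4 <= a)%N -> a%:R^-1 <= 1 / 4 :> R.
  by move=> a4; rewrite div1r lef_pV2 ?posrE ?ltr0n ?ler_nat //; exact: leq_trans a4.
have lE a : (4 * a ^ 2)%:R = 4 * a%:R ^+ 2 :> R by rewrite natrM natrX.
have l1E a : (4 <= a)%N -> (4 * a ^ 2 - 1)%:R = 4 * a%:R ^+ 2 - 1 :> R.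
  by move=> a4; rewrite natrB ?lE // muln_gt0 expn_gt0; lia.
have zE a : (4 <= a)%N -> a%:R^-1 / 4 = a%:R / (4 * a ^ 2)%:R :> R.
  by move=> a4; rewrite lE; field; exact: yN.
have z1E a : (4 <= a)%N ->
  a%:R^-1 * (1 + a%:R^-1) / 4 = (a + 1)%:R / (4 * a ^ 2)%:R :> R.
  by move=> a4; rewrite lE natrD; field; exact: yN.
have zlE a : (4 <= a)%N ->
  a%:R^-1 / (4 - a%:R^-1 ^+ 2) = a%:R / (4 * a ^ 2 - 1)%:R :> R.
  move=> a4; rewrite l1E //; field; rewrite yN //=.
  have : 4 <= a%:R :> R by rewrite ler_nat.
  by move=> ?; rewrite !gt_eqF //; nra.
split; [|split; [|split; [|split; [|split; [|split]]]]].
(* For [z = y / 4] the main term in [z] equals the claimed expansion exactly, hence [D := 0]. *)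
- apply: (eqaddO_inv_exp (N := 4) (D := 0)) => a a4.
    by apply: (ln_g_asymptotic _ _ _ _ _ _ (zE a a4)); rewrite -?mulnn; nia.
  rewrite mul0r; set X := _ - _; suff -> : X = 0 by rewrite normr0.
  by rewrite /X; field; exact: yN.
- apply: (eqaddO_inv_exp (N := 4) (D := 0)) => a a4.
    by apply: (ln_h_asymptotic _ _ _ _ (zE a a4)); rewrite -?mulnn; nia.
  rewrite mul0r; set X := _ - _; suff -> : X = 0 by rewrite normr0.
  by rewrite /X; field; exact: yN.
- apply: (eqaddO_inv_exp (N := 4) (D := 10)) => a a4.
    by apply: (ln_g_asymptotic _ _ _ _ _ _ (z1E a a4)); rewrite -?mulnn; nia.
  have := g_expansion_shifted (y0 a a4) (y4 a a4) erefl.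
  rewrite -exprVn; congr (`| _ | <= _); rewrite natrD; field; exact: yN.
- apply: (eqaddO_inv_exp (N := 4) (D := 10)) => a a4.
    by apply: (ln_h_asymptotic _ _ _ _ (z1E a a4)); rewrite -?mulnn; nia.
  have := h_expansion_shifted (y0 a a4) (y4 a a4) erefl.
  rewrite -exprVn; congr (`| _ | <= _); field; exact: yN.
- apply: (eqaddO_inv_exp (N := 4) (D := 10)) => a a4.
    by apply: (ln_g_asymptotic _ _ _ _ _ _ (zlE a a4)); rewrite -?mulnn; nia.
  have := g_expansion_lagged (y0 a a4) (y4 a a4) erefl.
  rewrite -exprVn; congr (`| _ | <= _); set z := _ / (4 - _); field; exact: yN.
- apply: (eqaddO_inv_exp (N := 4) (D := 10)) => a a4.
    by apply: (ln_h_asymptotic _ _ _ _ (zlE a a4)); rewrite -?mulnn; nia.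
  have := h_expansion_lagged (y0 a a4) (y4 a a4) erefl.
  rewrite -exprVn; congr (`| _ | <= _); set z := _ / (4 - _); field; exact: yN.
- move=> a a3 l l' al ll' la.
  split; apply: (g_div_h_lt R _ _ _ al ll' la).
  + by lia.
  + by rewrite -mulnn; nia.
  + move=> n; rewrite -!mulnn => ln nu.
    (* For [a >= 3], [4 (a + 1)^2 <= 8 a^2]. As [n > 4 a^2], this gives
       [n^2 + 3 a^2 < n^2 + n <= 8 n a^2]. *)
    have n8 : (n < 8 * (a * a))%N by nia.
    by nia.
  + by lia.
  + by rewrite -mulnn; nia.
  + move=> n; rewrite -!mulnn => ln nu.
    (* The slack [4 n] absorbs [3 (a + 1)^2], since [n > 4 a^2 >= (a + 1)^2]. *)
    have n8 : (n + 4 <= 8 * (a * a))%N by nia.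
    by nia.
Qed.
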